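(* Let $\rho$ be an $n$-qubit mixed state with bipartition $A|B$ and Schmidt number $s(\rho)$. Then $\mathcal{E}(\rho)\le\ln s(\rho)$. Consequently $\mathcal{E}_4(\rho)\le\ln s(\rho)$, and similarly $\mathcal{C}_4(\rho)\le\ln s(\rho)$.
   Context: For a pure state $|\psi\rangle$, $s(|\psi\rangle)$ is its Schmidt rank across $A|B$; for a mixed state, the Schmidt number is $s(\rho)=\min_{\rho=\sum_ip_i|\psi_i\rangle\langle\psi_i|}\max_i s(|\psi_i\rangle)$, the minimum being over all pure-state decompositions of $\rho$. The partial transpose on $B$ is $(X_A\otimes Y_B)^\Gamma=X_A\otimes Y_B^T$; $\mathcal{E}(\rho)=\ln\|\rho^\Gamma\|_1$; $p_\alpha=\mathrm{tr}((\rho^\Gamma)^\alpha)$; $\mathcal{E}_4(\rho)=\frac12\ln(p_2^3/p_4)$. The realignment matrix is $\langle a,a'|R_\rho|b,b'\rangle=\langle a,b|\rho|a',b'\rangle$; $r_\alpha=\mathrm{tr}((R_\rho^\dagger R_\rho)^{\alpha/2})$; $\mathcal{C}_4(\rho)=\frac12\ln(r_2^3/r_4)$. *)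

(* Defs.v *)
From HB Require Import structures.
From mathcomp Require Import all_boot all_order all_algebra.
From mathcomp Require Import spectral sesquilinear.
From mathcomp Require Import boolp classical_sets reals exp.
From mathcomp Require Import complex.

Set Implicit Arguments.
Unset Strict Implicit.
Unset Printing Implicit Defensive.

Import Order.TTheory GRing.Theory Num.Theory.
Local Open Scope ring_scope.
Local Open Scope complex_scope.
Local Open Scope sesquilinear_scope.

(* The computational basis of the qubits indexed by the finite type Q.
   Operators and vectors are MathComp matrices over the enumeration of the
   basis; [ent] and [mkop] give access by basis labels. *)
Notation bits Q := {ffun Q -> bool}.
Notation dimq Q := #|{: bits Q}|.
Notation subsys A := {i | i \in A}.

Section BasisLabels.
Variables (K : Type) (S T : finType).

Definition ent (M : 'M[K]_(#|S|, #|T|)) (x : S) (y : T) : K :=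
  M (enum_rank x) (enum_rank y).

Definition mkop (f : S -> T -> K) : 'M[K]_(#|S|, #|T|) :=
  \matrix_(i, j) f (enum_val i) (enum_val j).

Lemma ent_mkop f x y : ent (mkop f) x y = f x y.
Proof. by rewrite /ent mxE !enum_rankK. Qed.

End BasisLabels.

Definition restr (n : nat) (A : {set 'I_n}) (x : bits 'I_n) : bits (subsys A) :=
  [ffun i => x (val i)].

(* The joint label |a, b>. The final [false] is never reached. *)
Definition glue (n : nat) (A : {set 'I_n})
    (a : bits (subsys A)) (b : bits (subsys (~: A))) : bits 'I_n :=
  [ffun i => if insub i is Some j then a j
             else if insub i is Some j then b j else false].

Lemma restr_glueA n (A : {set 'I_n}) a b : restr A (glue a b) = a.
Proof. by apply/ffunP => -[i iA]; rewrite !ffunE insubT. Qed.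

Lemma restr_glueB n (A : {set 'I_n}) a b : restr (~: A) (glue a b) = b.
Proof.
apply/ffunP => -[i iB]; rewrite !ffunE insubF ?insubT //=.
by apply/negbTE; rewrite -finset.in_setC.
Qed.

Lemma glue_restr n (A : {set 'I_n}) x :
  glue (restr A x) (restr (~: A) x) = x.
Proof.
apply/ffunP => i; rewrite ffunE.
case: insubP => [j _ <-|iA]; first by rewrite ffunE.
by case: insubP => [j _ <-|]; [rewrite ffunE | rewrite finset.in_setC iA].
Qed.

(* Least element of a set of naturals (0 for the empty set). *)
Definition natmin (S : set nat) : nat :=
  if pselect (exists k, `[< S k >]) is left h then ex_minn h else 0%N.

Lemma natminP (S : set nat) k : S k -> S (natmin S) /\ (natmin S <= k)%N.
Proof.
move=> Sk; rewrite /natmin; case: pselect => [h|[]]; last first.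
  by exists k; apply/asboolP.
by case: ex_minnP => m /asboolP Sm min_m; split=> //; apply/min_m/asboolP.
Qed.

Section States.
Variables (R : realType) (n : nat).
Local Notation C := R[i].
Local Notation ket := 'cV[C]_(dimq 'I_n).
Local Notation op := 'M[C]_(dimq 'I_n).

Definition pure_state (psi : ket) : Prop := psi^t* *m psi = 1%:M.

(* [0 <= z] on complex numbers includes that z is real. *)
Definition mixed_state (rho : op) : Prop :=
  [/\ rho \is hermsymmx,
      forall v : ket, 0 <= (v^t* *m rho *m v) 0 0 &
      \tr rho = 1].

Section Bipartition.
Variable A : {set 'I_n}.
Local Notation B := (~: A).

(* psi = \sum_k lam_k |u_k> (x) |v_k> with lam_k > 0 and (u_k), (v_k)
   orthonormal: these are the rows of U and V, since for rectangular matrices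
   [unitarymx] means M *m M^t* = 1%:M. *)
Definition schmidt_decomposition (psi : ket) (r : nat) (lam : 'I_r -> R)
    (U : 'M[C]_(r, dimq (subsys A))) (V : 'M[C]_(r, dimq (subsys B))) : Prop :=
  [/\ forall k, 0 < lam k, U \is unitarymx, V \is unitarymx &
      forall (a : bits (subsys A)) (b : bits (subsys B)),
        psi (enum_rank (glue a b)) 0 =
        \sum_(k < r) (lam k)%:C * U k (enum_rank a) * V k (enum_rank b)].

(* All Schmidt decompositions of psi have the same number of terms. *)
Definition schmidt_rank (psi : ket) : nat :=
  natmin [set r | exists lam U V, @schmidt_decomposition psi r lam U V].

Definition pure_decomposition (rho : op) (m : nat) (p : 'I_m -> R)
    (psi : 'I_m -> ket) : Prop :=
  [/\ forall i, 0 <= p i, \sum_(i < m) p i = 1, forall i, pure_state (psi i) &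
      rho = \sum_(i < m) (p i)%:C *: (psi i *m (psi i)^t*)].

Definition schmidt_number (rho : op) : nat :=
  natmin [set s | exists m (p : 'I_m -> R) (psi : 'I_m -> ket),
            pure_decomposition rho p psi /\
            s = (\max_(i < m) schmidt_rank (psi i))%N].

(* <a, b|rho^Gamma|a', b'> = <a, b'|rho|a', b> *)
Definition ptrans (rho : op) : op :=
  mkop (fun x y => ent rho (glue (restr A x) (restr B y))
                           (glue (restr A y) (restr B x))).

Definition tensop (X : 'M[C]_(dimq (subsys A))) (Y : 'M[C]_(dimq (subsys B))) : op :=
  mkop (fun x y => ent X (restr A x) (restr A y) *
                   ent Y (restr B x) (restr B y)).

Lemma ptrans_tensop X Y : ptrans (tensop X Y) = tensop X Y^T.
Proof.
apply/matrixP => i j; rewrite !mxE ent_mkop !restr_glueA !restr_glueB.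
by rewrite /ent mxE.
Qed.

Definition realign (rho : op) :
    'M[C]_(#|{: bits (subsys A) * bits (subsys A)}|,
           #|{: bits (subsys B) * bits (subsys B)}|) :=
  mkop (fun aa bb => ent rho (glue aa.1 bb.1) (glue aa.2 bb.2)).

End Bipartition.
End States.

(* ||X||_1 = tr sqrt(X^dagger X), the sum of the square roots of the
   eigenvalues of the Hermitian matrix X^dagger X. *)
Definition trace_norm (R : realType) (d : nat) (X : 'M[R[i]]_d) : R :=
  \sum_(i < d) Num.sqrt (complex.Re (spectral_diag (X^t* *m X) 0 i)).

Section Entropies.
Variables (R : realType) (n : nat) (A : {set 'I_n}).
Local Notation op := 'M[R[i]]_(dimq 'I_n).

Definition log_negativity (rho : op) : R := ln (trace_norm (ptrans A rho)).

(* This trace is real since rho^Gamma is Hermitian. *)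
Definition pt_moment (k : nat) (rho : op) : R :=
  complex.Re (\tr (ptrans A rho ^+ k)).

Definition log_negativity4 (rho : op) : R :=
  2^-1 * ln (pt_moment 2 rho ^+ 3 / pt_moment 4 rho).

(* The moments of even order alpha = 2 k, where tr ((R^dagger R)^(alpha/2)) is
   the trace of a natural power. *)
Definition even_realign_moment (k : nat) (rho : op) : R :=
  complex.Re (\tr (((realign A rho)^t* *m realign A rho) ^+ k)).

Definition ccnr_negativity4 (rho : op) : R :=
  2^-1 * ln (even_realign_moment 1 rho ^+ 3 / even_realign_moment 2 rho).

End Entropies.

(* Main.v *)
(** A Schmidt decomposition of a pure state writes both the partial transpose and
    the realignment of its projector as [\sum_(k, l) lam_k lam_l |x_kl><y_kl|] with
    unit vectors, so their nuclear norms are at most [(\sum_k lam_k)^2], which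
    Cauchy-Schwarz bounds by the Schmidt rank. By convexity the nuclear norms
    for a mixed state are at most its Schmidt number. Both moment ratios are then
    bounded by the interpolation [(\sum s_i^2)^3 <= (\sum s_i)^2 (\sum s_i^4)] between
    singular values.

    Convexity and the rank-one bound are immediate for the dual description of the
    nuclear norm, as the supremum of [Re (tr (K^* X))] over contractions [K]; the polar
    decomposition shows that this dominates the sum of the singular values. *)

Require Import Defs.
From mathcomp Require Import all_boot all_order all_algebra.
From mathcomp Require Import spectral sesquilinear.
From mathcomp Require Import boolp classical_sets reals exp complex.
From mathcomp Require Import ring lra.
Set Implicit Arguments.
Unset Strict Implicit.
Unset Printing Implicit Defensive.
Import Order.TTheory GRing.Theory Num.Theory.
Local Open Scope ring_scope.

(** * Real inequalities between power sums *)

(** Expanding [0 <= \sum_i w i * (W * g i - B) ^+ 2] gives [0 <= W * (W * Q - B ^+ 2)]. Dividing by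
    [W] yields the claim, and [W = 0] forces every weight to vanish. *)
Lemma weighted_cauchy_schwarz (R : realFieldType) (I : finType) (w g : I -> R) :
  (forall i, 0 <= w i) ->
  (\sum_i w i * g i) ^+ 2 <= (\sum_i w i) * \sum_i w i * g i ^+ 2.
Proof.
move=> w0; set W := \sum_i w i; set B := \sum_i w i * g i; set Q := (X in _ <= _ * X).
have W0 : 0 <= W by apply: sumr_ge0.
have [W_eq0|Wn0] := eqVneq W 0.
  have /(_ _ isT) wz := psumr_eq0P (fun i _ => w0 i) W_eq0.
  suff -> : B = 0 by rewrite W_eq0 mul0r expr0n.
  by apply: big1 => i _; rewrite wz // mul0r.
have : 0 <= \sum_i w i * (W * g i - B) ^+ 2.
  by apply: sumr_ge0 => i _; rewrite mulr_ge0 ?sqr_ge0.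
have -> : \sum_i w i * (W * g i - B) ^+ 2 = W * (W * Q - B ^+ 2).
  transitivity (W ^+ 2 * Q - 2 * W * B * B + B ^+ 2 * W); last by ring.
  rewrite [W ^+ 2 * _]mulr_sumr [2 * W * B * _]mulr_sumr [B ^+ 2 * _]mulr_sumr.
  by rewrite -sumrB -big_split /=; apply: eq_bigr => i _; ring.
by rewrite pmulr_rge0 ?subr_ge0 // lt_def Wn0.
Qed.

(** Cauchy-Schwarz with weights [f i] gives [S2 ^+ 2 <= S1 * S3], and with weights [f i ^+ 2] it
    gives [S3 ^+ 2 <= S2 * S4]. Squaring the first eliminates [S3], and a factor [S2] cancels. *)
Lemma moment_interpolation (R : realFieldType) (I : finType) (f : I -> R) :
  (forall i, 0 <= f i) ->
  (\sum_i f i ^+ 2) ^+ 3 <= (\sum_i f i) ^+ 2 * \sum_i f i ^+ 4.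
Proof.
move=> f0; set S1 := \sum_i f i; set S2 := \sum_i f i ^+ 2; set S4 := \sum_i f i ^+ 4.
pose S3 := \sum_i f i ^+ 3.
have h1 : S2 ^+ 2 <= S1 * S3.
  rewrite /S2 /S3; under [X in X ^+ 2]eq_bigr do rewrite expr2.
  by under [X in _ * X]eq_bigr do rewrite exprS; apply: weighted_cauchy_schwarz.
have h2 : S3 ^+ 2 <= S2 * S4.
  rewrite /S3 /S4; under [X in X ^+ 2]eq_bigr do rewrite exprSr.
  under [X in _ * X]eq_bigr do rewrite (exprD _ 2 2).
  by apply: weighted_cauchy_schwarz => i; rewrite sqr_ge0.
have S2_ge0 : 0 <= S2 by apply: sumr_ge0 => i _; rewrite sqr_ge0.
have S4_ge0 : 0 <= S4 by apply: sumr_ge0 => i _; rewrite exprn_even_ge0.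
have [->|S2n0] := eqVneq S2 0; first by rewrite expr0n mulr_ge0 ?sqr_ge0.
have S2_gt0 : 0 < S2 by rewrite lt_def S2n0.
rewrite -(ler_pM2l S2_gt0) -exprS.
have := lerXn2r 2 _ _ h1; rewrite !nnegrE => /(_ (sqr_ge0 _)).
rewrite (le_trans (sqr_ge0 _) h1) => /(_ isT).
rewrite -exprM exprMn => /le_trans; apply.
by rewrite [S2 * _]mulrCA ler_wpM2l ?sqr_ge0.
Qed.


(** * Complex numbers and norms of vectors *)

Section ComplexMatrices.
Variable R : realType.
Local Notation C := R[i]%C.
Local Notation "x %:C" := (real_complex R x).
Local Notation Re := (@complex.Re R).
Local Open Scope sesquilinear_scope.

Lemma trCmx_mul m n p (M : 'M[C]_(m, n)) (N : 'M[C]_(n, p)) :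
  (M *m N)^t* = N^t* *m M^t*.
Proof. by rewrite trmx_mul map_mxM. Qed.

Lemma Re_le (x y : C) : x <= y -> Re x <= Re y.
Proof. by rewrite lecE => /andP[]. Qed.

Lemma ReC (x : C) : 0 <= x -> (Re x)%:C = x.
Proof. by move=> x0; rewrite RRe_real // ger0_real. Qed.

Lemma ReD (x y : C) : Re (x + y) = Re x + Re y.
Proof. by case: x y => [a b] [c d]. Qed.

Lemma Re_sum (I : finType) (F : I -> C) : Re (\sum_i F i) = \sum_i Re (F i).
Proof. by apply: (big_morph Re ReD). Qed.

Lemma Re_realM (c : R) (z : C) : Re (c%:C * z) = c * Re z.
Proof. by case: z => a b; rewrite /= mul0r subr0. Qed.

Lemma Re_conj (z : C) : Re z^* = Re z.
Proof. by case: z. Qed.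

Lemma conj_realC (x : R) : (x%:C)^* = x%:C.
Proof. exact: conjc_real. Qed.

Lemma conjCM (x y : C) : (x * y)^* = x^* * y^*.
Proof. exact: rmorphM. Qed.

Lemma conjCB (x y : C) : (x - y)^* = x^* - y^*.
Proof. exact: rmorphB. Qed.

Lemma conjC_sum (I : finType) (F : I -> C) : (\sum_i F i)^* = \sum_i (F i)^*.
Proof. exact: rmorph_sum. Qed.

Lemma mxtrace_sum n (I : finType) (F : I -> 'M[C]_n) :
  \tr (\sum_i F i) = \sum_i \tr (F i).
Proof. exact: raddf_sum. Qed.

Definition sqnorm n (v : 'cV[C]_n) : C := (v^t* *m v) 0 0.

Lemma sqnormE n (v : 'cV[C]_n) : sqnorm v = \sum_i v i 0 * (v i 0)^*.
Proof.
by rewrite /sqnorm mxE; apply: eq_bigr => i _; rewrite !mxE mulrC.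
Qed.

Lemma sqnorm_ge0 n (v : 'cV[C]_n) : 0 <= sqnorm v.
Proof. by rewrite sqnormE; apply: sumr_ge0 => i _; rewrite mul_conjC_ge0. Qed.

Lemma sqnorm_unitary n (V : 'M[C]_n) (v : 'cV[C]_n) :
  V \is unitarymx -> sqnorm (V *m v) = sqnorm v.
Proof.
move=> Vu; rewrite /sqnorm trCmx_mul mulmxA -(mulmxA _ (V^t*)).
by rewrite (mulmx1C (unitarymxP Vu)) mulmx1.
Qed.

(** Summing [|u_i - v_i|^2 >= 0] over the entries bounds twice the real part by
    [sqnorm u + sqnorm v]. *)
Lemma Re_dot_le n (u v : 'cV[C]_n) :
  sqnorm u <= 1 -> sqnorm v <= 1 -> Re ((u^t* *m v) 0 0) <= 1.
Proof.

move=> u1 v1; set a := (u^t* *m v) 0 0.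
have h : a + a^* <= sqnorm u + sqnorm v.
  rewrite !sqnormE -big_split /= /a mxE conjC_sum -big_split /=.
  apply: ler_sum => i _; rewrite !mxE conjCM conjCK -subr_ge0.
  have := mul_conjC_ge0 (u i 0 - v i 0); rewrite conjCB.
  by congr (0 <= _); ring.
have /Re_le := le_trans h (lerD u1 v1).
by rewrite !ReD Re_conj /=; lra.
Qed.

Lemma sqnorm_col m n (X : 'M[C]_(m, n)) i : sqnorm (col i X) = (X^t* *m X) i i.
Proof. by rewrite /sqnorm !mxE; apply: eq_bigr => k _; rewrite !mxE. Qed.

Lemma gram_normal m n (X : 'M[C]_(m, n)) : X^t* *m X \is normalmx.
Proof. by apply/normalmxP; rewrite trCmx_mul trmxCK. Qed.

(** * Singular values through the Gram matrix *)

(** The summand of [trace_norm], extended to rectangular matrices: one value per column, zeros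
    included. *)
Definition sing_val m n (X : 'M[C]_(m, n)) (i : 'I_n) : R :=
  Num.sqrt (Re (spectral_diag (X^t* *m X) 0 i)).

Lemma sing_val_ge0 m n (X : 'M[C]_(m, n)) i : 0 <= sing_val X i.
Proof. exact: sqrtr_ge0. Qed.

Definition rsing_basis m n (X : 'M[C]_(m, n)) : 'M[C]_n := spectralmx (X^t* *m X).

Lemma rsing_basis_unitary m n (X : 'M[C]_(m, n)) : rsing_basis X \is unitarymx.
Proof. exact: spectral_unitarymx. Qed.

Lemma unitary_diag n (M V : 'M[C]_n) d :
  V \is unitarymx -> M = V^t* *m diag_mx d *m V -> V *m M *m V^t* = diag_mx d.
Proof. by move=> Vu ->; rewrite !mulmxA (unitarymxP Vu) mul1mx mulmxtVK. Qed.

(** The eigenvalues are the squared norms of the columns of [X *m V^t*], hence real and nonnegative,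
    so squaring their real square roots recovers them. *)
Lemma gram_spectral m n (X : 'M[C]_(m, n)) :
  X^t* *m X = (rsing_basis X)^t* *m diag_mx (\row_i (sing_val X i ^+ 2)%:C)
              *m rsing_basis X.
Proof.
set V := rsing_basis X; have Vu : V \is unitarymx := rsing_basis_unitary X.
have eG : X^t* *m X = V^t* *m diag_mx (spectral_diag (X^t* *m X)) *m V.
  by rewrite -invmx_unitary //; apply/orthomx_spectralP/gram_normal.
rewrite [LHS]eG; congr (_ *m diag_mx _ *m _); apply/rowP => i; rewrite [RHS]mxE.
have d0 : 0 <= spectral_diag (X^t* *m X) 0 i.
  suff -> : spectral_diag (X^t* *m X) 0 i = sqnorm (col i (X *m V^t*)).
    exact: sqnorm_ge0.
  rewrite sqnorm_col trCmx_mul trmxCK !mulmxA -(mulmxA V).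
  by rewrite (unitary_diag Vu eG) mxE eqxx mulr1n.
by rewrite sqr_sqrtr ?ReC // -lecR ReC.
Qed.

Lemma gram_mulU m n (X : 'M[C]_(m, n)) :
  (X *m (rsing_basis X)^t*)^t* *m (X *m (rsing_basis X)^t*) =
  diag_mx (\row_i (sing_val X i ^+ 2)%:C).
Proof.
rewrite trCmx_mul trmxCK !mulmxA -(mulmxA (rsing_basis X)).
exact: unitary_diag (rsing_basis_unitary X) (gram_spectral X).
Qed.

Lemma trace_gram_exp m n (X : 'M[C]_(m, n)) k :
  Re (\tr ((X^t* *m X) ^+ k)) = \sum_i sing_val X i ^+ (2 * k).
Proof.
set V := rsing_basis X; have Vu : V \is unitarymx := rsing_basis_unitary X.
have VV : V^t* *m V = 1%:M := mulmx1C (unitarymxP Vu).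
suff -> : (X^t* *m X) ^+ k =
    V^t* *m diag_mx (\row_i (sing_val X i ^+ (2 * k))%:C) *m V.
  rewrite -mulmxA mxtrace_mulC mulmxtVK // mxtrace_diag Re_sum.
  by apply: eq_bigr => i _; rewrite mxE.
elim: k => [|k IH].
  rewrite expr0 muln0; set D := diag_mx _.
  suff -> : D = 1%:M by rewrite mulmx1 VV.
  by apply/matrixP => i j; rewrite !mxE.
rewrite exprSr IH [X in _ * X]gram_spectral -/V -[_ * _]/(_ *m _) !mulmxA mulmxtVK //.
rewrite -!(mulmxA (V^t*)) mulmx_diag; congr (_ *m (diag_mx _ *m _)).
by apply/rowP => i; rewrite !mxE -rmorphM /= -exprD addnC -mulnS.
Qed.

(** * The nuclear norm by duality *)

Definition contraction m n (K : 'M[C]_(m, n)) : Prop :=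
  forall v, sqnorm (K *m v) <= sqnorm v.

(* The bound [nuclear norm of X <= c], stated through the dual norm. *)
Definition nuclear_le m n (X : 'M[C]_(m, n)) (c : R) : Prop :=
  forall K : 'M[C]_(m, n), contraction K -> Re (\tr (K^t* *m X)) <= c.

(** By cyclicity the trace is the inner product of [K *m y] with [x], and [K] keeps [y] in the unit
    ball. *)
Lemma nuclear_le_rank1 m n (x : 'cV[C]_m) (y : 'cV[C]_n) :
  sqnorm x <= 1 -> sqnorm y <= 1 -> nuclear_le (x *m y^t*) 1.
Proof.
move=> x1 y1 K Kc; rewrite mulmxA mxtrace_mulC mulmxA -trCmx_mul.
rewrite /mxtrace big_ord1; apply: Re_dot_le => //; exact: le_trans (Kc y) y1.
Qed.

Lemma nuclear_le_sum m n (I : finType) (c N : I -> R) (F : I -> 'M[C]_(m, n)) :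
  (forall i, 0 <= c i) -> (forall i, nuclear_le (F i) (N i)) ->
  nuclear_le (\sum_i (c i)%:C *: F i) (\sum_i c i * N i).
Proof.
move=> c0 FN K Kc; rewrite mulmx_sumr mxtrace_sum Re_sum; apply: ler_sum => i _.
by rewrite -scalemxAr mxtraceZ Re_realM ler_wpM2l ?FN.
Qed.

(* The witness is the partial isometry of the polar decomposition of [X]. *)
Lemma sum_sing_val_le m n (X : 'M[C]_(m, n)) c :
  nuclear_le X c -> \sum_i sing_val X i <= c.
Proof.
set V := rsing_basis X; have Vu : V \is unitarymx := rsing_basis_unitary X.
have YY := gram_mulU X; move: YY; rewrite -/V; set Y := X *m V^t* => YY.
have XV : X *m V^t* = Y by []; clearbody Y.
(* Since [0^-1 = 0], [E] is the pseudo-inverse of the diagonal matrix of singular values. *)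
pose E := diag_mx (\row_i ((sing_val X i)^-1)%:C).
have EE : E^t* = E.
  rewrite /E tr_diag_mx map_diag_mx; congr diag_mx; apply/rowP => i.
  by rewrite !mxE; apply: conj_realC.
move=> /(_ (Y *m E *m V)) Xc; rewrite (le_trans _ (Xc _)) //.
  (* The trace becomes that of [E *m (Y^t* *m Y)], whose diagonal entries [s^-1 * s ^+ 2] equal [s],
     also at [s = 0]. *)
  rewrite trCmx_mul trCmx_mul EE -!mulmxA mxtrace_mulC -!mulmxA XV YY.
  rewrite mulmx_diag mxtrace_diag Re_sum; apply: ler_sum => i _; rewrite !mxE.
  rewrite -rmorphM /= expr2 mulrA.
  have [->|s0] := eqVneq (sing_val X i) 0; first by rewrite mulr0.
  by rewrite mulVf ?mul1r.
(* Contraction: [E *m (Y^t* *m Y) *m E] is diagonal with entries 0 or 1. *)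
move=> v; rewrite -mulmxA -(sqnorm_unitary v Vu); set w := V *m v.
rewrite /sqnorm -mulmxA (trCmx_mul Y) (trCmx_mul E) EE -!mulmxA (mulmxA (Y^t*)) YY.
rewrite (mulmxA E) /E mulmx_diag (mulmxA (diag_mx _)) mulmx_diag mul_diag_mx.
rewrite !mxE; apply: ler_sum => i _; rewrite !mxE.
have [s0|s0] := eqVneq (sing_val X i) 0.
  by rewrite s0 invr0 !mul0r mulr0 mulrC mul_conjC_ge0.
by rewrite -!rmorphM /= expr2 mulKf // mulfV // mul1r.
Qed.

Lemma moment_interpolation_sing_val m n (X : 'M[C]_(m, n)) c :
  nuclear_le X c ->
  Re (\tr ((X^t* *m X) ^+ 1)) ^+ 3 <= c ^+ 2 * Re (\tr ((X^t* *m X) ^+ 2)).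
Proof.
move=> Xc; rewrite !trace_gram_exp.
apply: le_trans (moment_interpolation (sing_val_ge0 X)) _.
apply: ler_wpM2r; first by apply: sumr_ge0 => i _; rewrite exprn_ge0 ?sing_val_ge0.
have S0 : 0 <= \sum_i sing_val X i by apply: sumr_ge0 => i _; apply: sing_val_ge0.
have := sum_sing_val_le Xc => Sc.
by rewrite lerXn2r ?nnegrE // (le_trans S0).
Qed.

Lemma nuclear_leW m n (X : 'M[C]_(m, n)) c d :
  c <= d -> nuclear_le X c -> nuclear_le X d.
Proof. by move=> cd Xc K Kc; apply: le_trans cd; apply: Xc. Qed.

Lemma unitary_dot m n (U : 'M[C]_(m, n)) k l :
  U \is unitarymx -> \sum_i U k i * (U l i)^* = (k == l)%:R.
Proof.
move=> /unitarymxP/matrixP/(_ k l); rewrite !mxE => <-.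
by apply: eq_bigr => i _; rewrite !mxE.
Qed.

(** * Existence of singular value and spectral decompositions *)

(** Only the nonzero singular values are kept; the left vectors are the normalised columns of
    [M *m W^t*]. The absence of conjugates matches [schmidt_decomposition]. *)
Lemma svd_exists m n (M : 'M[C]_(m, n)) :
  exists r (lam : 'I_r -> R) (U : 'M[C]_(r, m)) (V : 'M[C]_(r, n)),
    [/\ forall k, 0 < lam k, U \is unitarymx, V \is unitarymx &
        forall a b, M a b = \sum_k (lam k)%:C * U k a * V k b].
Proof.
set W := rsing_basis M; have Wu : W \is unitarymx := rsing_basis_unitary M.
have YY := gram_mulU M; move: YY; rewrite -/W; set Y := M *m W^t* => YY.
have MY : M = Y *m W by rewrite /Y mulmxKtV.
have YYE i j : \sum_a (Y a i)^* * Y a j = (sing_val M i ^+ 2)%:C *+ (i == j).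
  have /matrixP/(_ i j) := YY; rewrite !mxE => <-.
  by apply: eq_bigr => a _; rewrite !mxE.
pose P := [pred i | sing_val M i != 0].
have Pnz (k : 'I_#|P|) : sing_val M (enum_val k) != 0 by have := enum_valP k.
exists #|P|, (fun k => sing_val M (enum_val k)),
  (\matrix_(k, a) ((sing_val M (enum_val k))^-1%:C * Y a (enum_val k))),
  (\matrix_(k, b) W (enum_val k) b); split.
- by move=> k; rewrite lt_def Pnz sing_val_ge0.
- apply/unitarymxP/matrixP => k l; rewrite !mxE.
  pose c := ((sing_val M (enum_val k))^-1 * (sing_val M (enum_val l))^-1)%:C.
  transitivity (c * \sum_a (Y a (enum_val l))^* * Y a (enum_val k)).
    rewrite mulr_sumr; apply: eq_bigr => a _; rewrite !mxE conjCM conj_realC.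
    by rewrite /c rmorphM /=; ring.
  rewrite /c YYE (inj_eq enum_val_inj) eq_sym; case: eqVneq => [->|_]; last first.
    by rewrite mulr0n mulr0.
  by rewrite mulr1n -rmorphM /= expr2 mulrA mulfVK // mulVf.
- apply/unitarymxP/matrixP => k l; rewrite !mxE.
  rewrite -(inj_eq enum_val_inj) -(unitary_dot _ _ Wu).
  by apply: eq_bigr => a _; rewrite !mxE.
(* The discarded columns of [Y] have norm zero, so [M = Y *m W] can be summed over [P] alone. *)
have Y0 a i : i \notin P -> Y a i = 0.
  move=> /negPn/eqP si0; have := YYE i i; rewrite eqxx si0 expr0n /=.
  have F0 j : true -> 0 <= (Y j i)^* * Y j i by rewrite mulrC mul_conjC_ge0.
  move=> /(psumr_eq0P F0)/(_ a isT)/eqP.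
  by rewrite mulrC mul_conjC_eq0 => /eqP.
move=> a b; rewrite {1}MY mxE; transitivity (\sum_(i in P) Y a i * W i b).
  rewrite [LHS](bigID [in P]) /= [X in _ + X]big1 ?addr0 // => i iP.
  by rewrite Y0 ?mul0r.
rewrite big_enum_val; apply: eq_bigr => k _; rewrite !mxE mulrA -rmorphM /=.
by rewrite mulfV // mul1r.
Qed.

(** Supplies a pure-state decomposition of every mixed state, so that the Schmidt number is a
    minimum over a nonempty set. *)
Lemma spectral_pure_sum n (M : 'M[C]_n) :
  M \is hermsymmx -> (forall v : 'cV[C]_n, 0 <= (v^t* *m M *m v) 0 0) ->
  exists (p : 'I_n -> R) (psi : 'I_n -> 'cV[C]_n),
    [/\ forall i, 0 <= p i, \sum_i (p i)%:C = \tr M,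
        forall i, (psi i)^t* *m psi i = 1%:M &
        M = \sum_i (p i)%:C *: (psi i *m (psi i)^t*)].
Proof.
move=> Mh M0; set V := spectralmx M; have Vu : V \is unitarymx := spectral_unitarymx M.
have eM : M = V^t* *m diag_mx (spectral_diag M) *m V.
  by rewrite -invmx_unitary //; apply/orthomx_spectralP/hermitian_normalmx.
have VMV := unitary_diag Vu eM.
(* Each eigenvalue is the quadratic form of [M] at the corresponding column of [V^t*]. *)
have d0 i : 0 <= spectral_diag M 0 i.
  have := M0 (col i (V^t*)); have /matrixP/(_ i i) := VMV.
  rewrite [RHS]mxE eqxx mulr1n => <-; congr (0 <= _).
  rewrite !mxE; apply: eq_bigr => k _; rewrite !mxE; congr (_ * _).
  by apply: eq_bigr => j _; rewrite !mxE conjCK.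
exists (fun i => Re (spectral_diag M 0 i)), (fun i => col i (V^t*)); split.
- by move=> i; rewrite -lecR ReC.
- rewrite [in RHS]eM -mulmxA mxtrace_mulC mulmxtVK // mxtrace_diag.
  by apply: eq_bigr => i _; rewrite ReC.
- move=> i; apply/matrixP => a b; rewrite !ord1 mxE [RHS]mxE eqxx.
  transitivity ((i == i)%:R : C); last by rewrite eqxx.
  rewrite -(unitary_dot i i Vu); apply: eq_bigr => k _.
  by rewrite !mxE conjCK.
rewrite [LHS]eM; apply/matrixP => a b; rewrite mxE summxE; apply: eq_bigr => i _.
rewrite mul_mx_diag !mxE ReC // big_ord1 !mxE conjCK; ring.
Qed.

End ComplexMatrices.

(** * Schmidt decompositions of kets *)

Section Bipartition.
Variables (R : realType) (n : nat) (A : {set 'I_n}).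
Local Notation C := R[i]%C.
Local Notation "x %:C" := (real_complex R x).
Local Notation Re := (@complex.Re R).
Local Notation B := (~: A)%SET.
Local Notation ket := 'cV[C]_(dimq 'I_n).
Local Notation op := 'M[C]_(dimq 'I_n).
Local Open Scope sesquilinear_scope.

Lemma sum_enum_val (S : finType) (F : S -> C) :
  \sum_(i < #|S|) F (enum_val i) = \sum_x F x.
Proof. by rewrite [RHS]big_enum_val. Qed.

Lemma sum_enum_rank (S : finType) (F : 'I_#|S| -> C) :
  \sum_x F (enum_rank x) = \sum_i F i.
Proof. by rewrite -sum_enum_val; apply: eq_bigr => i _; rewrite enum_valK. Qed.

Lemma sum_glue (F : bits 'I_n -> C) :
  \sum_x F x = \sum_(a : bits (subsys A)) \sum_(b : bits (subsys B)) F (glue a b).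
Proof.
pose g (p : bits (subsys A) * bits (subsys B)) := glue p.1 p.2.
rewrite pair_bigA /= (reindex g) //=.
exists (fun x => (restr A x, restr B x)) => [[a b]|x] _ /=.
  by rewrite restr_glueA restr_glueB.
exact: glue_restr.
Qed.

Lemma unitary_dot_bits (S : finType) r (U : 'M[C]_(r, #|S|)) k l :
  U \is unitarymx ->
  \sum_x U k (enum_rank x) * (U l (enum_rank x))^* = (k == l)%:R.
Proof.
move=> Uu; rewrite -(unitary_dot k l Uu).
exact: (sum_enum_rank (fun i => U k i * (U l i)^*)).
Qed.

Lemma exchange_big3 (I J K : finType) (F : I -> J -> K -> C) :
  \sum_i \sum_j \sum_k F i j k = \sum_k \sum_i \sum_j F i j k.
Proof.
by rewrite [RHS]exchange_big; apply: eq_bigr => i _; apply: exchange_big.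
Qed.

(** A singular value decomposition of the coefficient matrix is a Schmidt decomposition, so [natmin]
    is attained instead of taking its default 0. *)
Lemma schmidt_rankP (psi : ket) :
  exists lam U V, @schmidt_decomposition R n A psi (schmidt_rank A psi) lam U V.
Proof.
pose M : 'M[C]_(dimq (subsys A), dimq (subsys B)) :=
  mkop (fun a b => psi (enum_rank (glue a b)) 0).
have [r [lam [U [V [lam0 Uu Vu MUV]]]]] := svd_exists M.
have Sr : [set r | exists lam U V, @schmidt_decomposition R n A psi r lam U V]%classic r.
  exists lam, U, V; split=> // a b.
  by rewrite -MUV -(ent_mkop (fun a b => psi (enum_rank (glue a b)) 0)).
by have [] := natminP Sr.
Qed.

(** The squared norm of [psi] expands into a double sum over Schmidt terms, where orthonormality
    kills all terms with distinct indices. *)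
Lemma schmidt_coef_sum (psi : ket) r (lam : 'I_r -> R) U V :
  pure_state psi -> schmidt_decomposition (A := A) psi lam U V ->
  \sum_k lam k ^+ 2 = 1.
Proof.
move=> psi1 [lam0 Uu Vu psiE].
apply: (@complexI R); rewrite rmorph1.
transitivity (sqnorm psi); last by rewrite /sqnorm psi1 mxE eqxx.
rewrite sqnormE -sum_enum_rank sum_glue rmorph_sum /=.
under [RHS]eq_bigr => a _ do under eq_bigr => b _ do rewrite psiE.
transitivity (\sum_k \sum_l ((lam k)%:C * (lam l)%:C) *
   ((\sum_a U k (enum_rank a) * (U l (enum_rank a))^*) *
    (\sum_b V k (enum_rank b) * (V l (enum_rank b))^*))).
  apply: eq_bigr => k _; rewrite (bigD1 k) //= [X in _ + X]big1 ?addr0 => [|l lk].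
    by rewrite !unitary_dot_bits // eqxx !mulr1 expr2 rmorphM.
  by rewrite !unitary_dot_bits // eq_sym (negPf lk) mul0r mulr0.
transitivity (\sum_k \sum_l \sum_a \sum_b (lam k)%:C * (lam l)%:C *
   ((U k (enum_rank a) * (U l (enum_rank a))^*) *
    (V k (enum_rank b) * (V l (enum_rank b))^*))).
  apply: eq_bigr => k _; apply: eq_bigr => l _.
  rewrite mulr_suml mulr_sumr; apply: eq_bigr => a _.
  by rewrite mulr_sumr mulr_sumr.
rewrite exchange_big3; apply: eq_bigr => a _.
rewrite exchange_big3; apply: eq_bigr => b _.
rewrite conjC_sum mulr_suml; apply: eq_bigr => k _.
rewrite mulr_sumr; apply: eq_bigr => l _.
by rewrite !conjCM conj_realC; ring.
Qed.

(** Cauchy-Schwarz with unit weights. The double sum is the total weight of the rank-one terms in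
    the two expansions below. *)
Lemma schmidt_coef_sum_sq_le (psi : ket) r (lam : 'I_r -> R) U V :
  pure_state psi -> schmidt_decomposition (A := A) psi lam U V ->
  \sum_k \sum_l lam k * lam l <= r%:R.
Proof.
move=> psi1 hd.
have -> : \sum_k \sum_l lam k * lam l = (\sum_k lam k) ^+ 2.
  by rewrite expr2 big_distrlr.
have := @weighted_cauchy_schwarz _ _ (fun=> 1) lam (fun=> ler01).
rewrite (eq_bigr lam) => [|i _]; last by rewrite mul1r.
rewrite sumr_const card_ord [X in _ * X](eq_bigr (fun i => lam i ^+ 2)) => [|i _].
  by rewrite (schmidt_coef_sum psi1 hd) mulr1.
by rewrite mul1r.
Qed.

Lemma schmidt_rank_gt0 (psi : ket) : pure_state psi -> (0 < schmidt_rank A psi)%N.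
Proof.
move=> psi1; have [lam [U [V hd]]] := schmidt_rankP psi.
have := schmidt_coef_sum psi1 hd; case: (schmidt_rank A psi) lam {U V hd} => // lam.
by rewrite big_ord0 => /esym/eqP; rewrite oner_eq0.
Qed.

(** * Nuclear norm bounds for pure states *)

Lemma mkop_rank1_le (S T : finType) (f : S -> C) (g : T -> C) :
  \sum_x f x * (f x)^* <= 1 -> \sum_y g y * (g y)^* <= 1 ->
  nuclear_le (mkop (fun x y => f x * (g y)^*)) 1.
Proof.
move=> f1 g1.
have -> : mkop (fun x y => f x * (g y)^*) =
    (\col_i f (enum_val i)) *m (\col_i g (enum_val i))^t*.
  by apply/matrixP => i j; rewrite !mxE big_ord1 !mxE.
apply: nuclear_le_rank1; rewrite sqnormE.
  by under eq_bigr do rewrite mxE; rewrite (sum_enum_val (fun x => f x * (f x)^*)).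
by under eq_bigr do rewrite mxE; rewrite (sum_enum_val (fun x => g x * (g x)^*)).
Qed.

Lemma dot_sep (S T : finType) r s (U : 'M[C]_(r, #|S|)) (V : 'M[C]_(s, #|T|)) k l :
  U \is unitarymx -> V \is unitarymx ->
  \sum_x \sum_y (U k (enum_rank x) * (V l (enum_rank y))^*) *
                (U k (enum_rank x) * (V l (enum_rank y))^*)^* = 1.
Proof.
move=> Uu Vu.
transitivity ((\sum_x U k (enum_rank x) * (U k (enum_rank x))^*) *
    (\sum_y V l (enum_rank y) * (V l (enum_rank y))^*)).
  rewrite big_distrlr /=; apply: eq_bigr => x _; apply: eq_bigr => y _.
  by rewrite conjCM conjCK; ring.
by rewrite !unitary_dot_bits // !eqxx mulr1.
Qed.

Lemma ket_bra_ent (psi : ket) x y :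
  ent (psi *m psi^t*) x y = psi (enum_rank x) 0 * (psi (enum_rank y) 0)^*.
Proof. by rewrite /ent mxE big_ord1 !mxE. Qed.

(** Exchanging the [B] labels regroups the Schmidt terms as [lam k * lam l] times the outer product
    of [u_k (x) conj v_l] with [u_l (x) conj v_k], both unit vectors. *)
Lemma ptrans_pure_nuclear_le (psi : ket) : pure_state psi ->
  nuclear_le (ptrans A (psi *m psi^t*)) (schmidt_rank A psi)%:R.
Proof.
move=> psi1; have [lam [U [V hd]]] := schmidt_rankP psi.
apply: (nuclear_leW (schmidt_coef_sum_sq_le psi1 hd)).
case: hd => lam0 Uu Vu psiE; rewrite pair_bigA /=.
pose f (kl : 'I_(schmidt_rank A psi) * 'I_(schmidt_rank A psi)) (x : bits 'I_n) :=
  U kl.1 (enum_rank (restr A x)) * (V kl.2 (enum_rank (restr B x)))^*.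
have -> : ptrans A (psi *m psi^t*) =
    \sum_kl (lam kl.1 * lam kl.2)%:C *:
      mkop (fun x y => f kl x * (f (kl.2, kl.1) y)^*).
  apply/matrixP => i j; rewrite summxE !mxE ket_bra_ent !psiE conjC_sum.
  rewrite big_distrlr pair_bigA /=; apply: eq_bigr => -[k l] _.
  by rewrite !mxE /f /= !conjCM conjCK conj_realC rmorphM /=; ring.
(* The factor 1 is the nuclear bound of each rank-one term, in the shape of [nuclear_le_sum]. *)
under eq_bigr do rewrite -[_ * _]mulr1.
apply: nuclear_le_sum => [kl|kl]; first by rewrite mulr_ge0 // ltW.
have f1 kl' : \sum_x f kl' x * (f kl' x)^* <= 1.
  rewrite sum_glue /f /=; under eq_bigr => a _ do
    under eq_bigr => b _ do rewrite restr_glueA restr_glueB.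
  by rewrite dot_sep.
exact: mkop_rank1_le.
Qed.

(** Realignment separates the [A] factors from the [B] factors: the term [k, l] is the product of
    [u_k (x) conj u_l] and [v_k (x) conj v_l]. *)
Lemma realign_pure_nuclear_le (psi : ket) : pure_state psi ->
  nuclear_le (realign A (psi *m psi^t*)) (schmidt_rank A psi)%:R.
Proof.
move=> psi1; have [lam [U [V hd]]] := schmidt_rankP psi.
apply: (nuclear_leW (schmidt_coef_sum_sq_le psi1 hd)).
case: hd => lam0 Uu Vu psiE; rewrite pair_bigA /=.
pose f (S : finType) (W : 'M[C]_(_, #|S|))
    (kl : 'I_(schmidt_rank A psi) * 'I_(schmidt_rank A psi)) (x : S * S) :=
  W kl.1 (enum_rank x.1) * (W kl.2 (enum_rank x.2))^*.
have -> : realign A (psi *m psi^t*) =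
    \sum_kl (lam kl.1 * lam kl.2)%:C *:
      (* Swapping both indices and labels conjugates [f]; the outer conjugate required by
         [mkop_rank1_le] undoes this. *)
      mkop (fun x y => f _ U kl x * (f _ V (kl.2, kl.1) (y.2, y.1))^*).
  apply/matrixP => i j; rewrite summxE !mxE ket_bra_ent !psiE conjC_sum.
  rewrite big_distrlr pair_bigA /=; apply: eq_bigr => -[k l] _.
  by rewrite !mxE /f /= !conjCM conjCK conj_realC rmorphM /=; ring.
under eq_bigr do rewrite -[_ * _]mulr1.
apply: nuclear_le_sum => [kl|kl]; first by rewrite mulr_ge0 // ltW.
apply: mkop_rank1_le.
  rewrite -(pair_bigA _ (fun x y => f _ U kl (x, y) * (f _ U kl (x, y))^*)) /f /=.
  by rewrite dot_sep.
rewrite -(pair_bigA _ (fun x y => f _ V (kl.2, kl.1) (y, x) *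
  (f _ V (kl.2, kl.1) (y, x))^*)) /f /= exchange_big.
by rewrite dot_sep.
Qed.

(** * Mixed states and the Schmidt number *)

Lemma schmidt_numberP (rho : op) : mixed_state rho ->
  exists m (p : 'I_m -> R) (psi : 'I_m -> ket),
    pure_decomposition rho p psi /\
    schmidt_number A rho = (\max_(i < m) schmidt_rank A (psi i))%N.
Proof.
move=> [rhoH rho0 rho1].
have [p [psi [p0 p1 psi1 rhoE]]] := spectral_pure_sum rhoH rho0.
pose S := [set s | exists m (p : 'I_m -> R) (psi : 'I_m -> ket),
   pure_decomposition rho p psi /\ s = (\max_(i < m) schmidt_rank A (psi i))%N]%classic.
have Ss : S (\max_i schmidt_rank A (psi i))%N.
  exists _, p, psi; split=> //; split=> //.
  by apply: (@complexI R); rewrite rmorph1 -rho1 -p1 rmorph_sum.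
by have [] := natminP Ss.
Qed.

(** Weights summing to 1 force at least one term, whose Schmidt rank is positive. This makes the
    logarithm of the Schmidt number nonnegative. *)
Lemma schmidt_number_gt0 (rho : op) : mixed_state rho -> (0 < schmidt_number A rho)%N.
Proof.
move=> /schmidt_numberP[m [p [psi [[p0 p1 psi1 _] ->]]]].
case: m p psi p0 p1 psi1 => [|m] p psi p0 p1 psi1.
  by move: p1; rewrite [X in X = _]big_ord0 => /esym/eqP; rewrite oner_eq0.
exact: leq_trans (schmidt_rank_gt0 (psi1 ord0)) (leq_bigmax ord0).
Qed.

(** Convexity for an optimal decomposition, with [L] abstract so as to serve both [ptrans] and
    [realign]. *)
Lemma mixed_nuclear_le (rho : op) k l (L : op -> 'M[C]_(k, l)) :
  mixed_state rho ->
  (forall m (p : 'I_m -> R) (F : 'I_m -> op),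
     L (\sum_i (p i)%:C *: F i) = \sum_i (p i)%:C *: L (F i)) ->
  (forall psi : ket, pure_state psi ->
     nuclear_le (L (psi *m psi^t*)) (schmidt_rank A psi)%:R) ->
  nuclear_le (L rho) (schmidt_number A rho)%:R.
Proof.
move=> /schmidt_numberP[m [p [psi [[p0 p1 psi1 ->] ->]]]] Llin Lpure.
rewrite Llin; apply: nuclear_leW (nuclear_le_sum p0 (fun i => Lpure _ (psi1 i))).
set s := (X in _ <= X); have -> : s = \sum_i p i * s by rewrite -mulr_suml p1 mul1r.
by apply: ler_sum => i _; rewrite ler_wpM2l // ler_nat leq_bigmax.
Qed.

Lemma ptrans_nuclear_le (rho : op) : mixed_state rho ->
  nuclear_le (ptrans A rho) (schmidt_number A rho)%:R.
Proof.
move=> rhoS; apply: (mixed_nuclear_le (L := @ptrans R n A)) ptrans_pure_nuclear_le => //.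
move=> m p F; apply/matrixP => i j; rewrite summxE !mxE /ent summxE.
by apply: eq_bigr => k _; rewrite !mxE.
Qed.

Lemma realign_nuclear_le (rho : op) : mixed_state rho ->
  nuclear_le (realign A rho) (schmidt_number A rho)%:R.
Proof.
move=> rhoS; apply: (mixed_nuclear_le (L := @realign R n A)) realign_pure_nuclear_le => //.
move=> m p F; apply/matrixP => i j; rewrite summxE !mxE /ent summxE.
by apply: eq_bigr => k _; rewrite !mxE.
Qed.

Lemma ptrans_herm (rho : op) : rho \is hermsymmx -> (ptrans A rho)^t* = ptrans A rho.
Proof.
move=> /is_hermitianmxP; rewrite expr0 scale1r => rhoH.
apply/matrixP => i j; rewrite !mxE /ent [in RHS]rhoH.
by rewrite [RHS]mxE [in RHS]mxE.
Qed.

(** Hermiticity turns even moments into traces of Gram powers, hence into power sums of singular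
    values. *)
Lemma pt_moment_double k (rho : op) : rho \is hermsymmx ->
  pt_moment A (2 * k) rho =
  Re (\tr (((ptrans A rho)^t* *m ptrans A rho) ^+ k)).
Proof. by move=> rhoH; rewrite /pt_moment exprM ptrans_herm // expr2. Qed.

End Bipartition.

(** * Passage to logarithms *)

(** For [x <= 0] the convention [ln x = 0] applies, and [1 <= s] makes the right-hand side
    nonnegative. *)
Lemma ln_le_lnW (R : realType) (x s : R) : 1 <= s -> x <= s -> ln x <= ln s.
Proof.
move=> s1 xs; have [x0|x0] := leP x 0; first by rewrite ln0 // ln_ge0.
by rewrite ler_ln // posrE (lt_le_trans x0).
Qed.

Lemma half_ln_ratio_le (R : realType) (a b s : R) :
  1 <= s -> 0 <= b -> a <= s ^+ 2 * b -> 2^-1 * ln (a / b) <= ln s.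
Proof.
move=> s1 b0 ab; have s0 : 0 < s by apply: lt_le_trans s1.
rewrite -ler_pdivlMl ?invr_gt0 // invrK mulr_natl -lnXn //.
apply: ln_le_lnW; first by rewrite exprn_ege1.
(* A zero denominator makes the quotient 0 by convention. *)
have [->|bn0] := eqVneq b 0; first by rewrite invr0 mulr0 sqr_ge0.
by rewrite ler_pdivrMr // lt_def bn0.
Qed.

Theorem mainTheorem10 (R : realType) (n : nat) (A : {set 'I_n})
    (rho : 'M[R[i]%C]_(dimq 'I_n)) :
  mixed_state rho ->
  [/\ log_negativity A rho <= ln ((schmidt_number A rho)%:R : R),
      log_negativity4 A rho <= ln ((schmidt_number A rho)%:R : R) &
      ccnr_negativity4 A rho <= ln ((schmidt_number A rho)%:R : R)].
Proof.
move=> rhoS; have s1 : 1 <= (schmidt_number A rho)%:R :> R.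
  by rewrite ler1n schmidt_number_gt0.
have PT := ptrans_nuclear_le A rhoS; have RA := realign_nuclear_le (A := A) rhoS.
have rhoH : rho \is hermsymmx by case: rhoS.
(* [trace_norm] unfolds to the sum of the [sing_val]. *)
split; first exact: ln_le_lnW (sum_sing_val_le PT).
- apply: half_ln_ratio_le => //; rewrite (pt_moment_double A 2) //.
    by rewrite trace_gram_exp; apply: sumr_ge0 => i _; rewrite exprn_ge0 ?sing_val_ge0.
  by rewrite (pt_moment_double A 1) //; apply: moment_interpolation_sing_val.
apply: half_ln_ratio_le => //; last exact: moment_interpolation_sing_val.
rewrite /even_realign_moment trace_gram_exp.
by apply: sumr_ge0 => i _; rewrite exprn_ge0 ?sing_val_ge0.
Qed.
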